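(* Let $f_0:\mathbb{R}^n\to\overline{\mathbb{R}}$, $F:\mathbb{R}^n\to\mathbb{R}^m\cup\{+\infty_\bullet\}$ and $g:\mathbb{R}^m\to\overline{\mathbb{R}}$. For $y\in\mathbb{R}^m$ let $\langle y,F\rangle(x)=\langle y,F(x)\rangle$ if $x\in\operatorname{dom}(F)$ and $+\infty$ otherwise; let $(f_0+g\circ F)(x)=f_0(x)+g(F(x))$ if $x\in\operatorname{dom}(F)$ and $+\infty$ otherwise. Define $f,h:\mathbb{R}^n\times\mathbb{R}^m\to\overline{\mathbb{R}}$ by $f(x,u)=f_0(x)+g(F(x)+u)$ and $h(x,u)=g(F(x)+u)$ if $x\in\operatorname{dom}(F)$, and $f(x,u)=h(x,u)=+\infty$ otherwise. Let $U=\operatorname{dom}(g)-F(\operatorname{dom}(f_0)\cap\operatorname{dom}(F))$ and define $\rho,\tilde\rho:\mathbb{R}^n\to\overline{\mathbb{R}}$ by $$\rho(\bar v):=\inf_{y\in\mathbb{R}^m}\left\{(f_0+\langle y,F\rangle)^*(\bar v)+g^*(y)\right\},\qquad \tilde\rho(\bar v):=\inf_{y\in\mathbb{R}^m,\ w\in\mathbb{R}^n}\left\{f_0^*(w)+(\langle y,F\rangle)^*(\bar v-w)+g^*(y)\right\}.$$ If $f_0\in\Gamma(\mathbb{R}^n)$, $f,h\in\Gamma(\mathbb{R}^n\times\mathbb{R}^m)$, and $h(x,u)$ is closed in $u$ (i.e. $h(x,\cdot)$ is closed for every $x$), then $f_0+g\circ F$ is convex, and $f_0+\langle\bar y,F\rangle,\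 \langle\bar y,F\rangle\in\Gamma(\mathbb{R}^n)$ for all $\bar y\in\operatorname{dom}(g^* )$. In addition, for all $\bar v\in\mathbb{R}^n$ $$(f_0+g\circ F)^*(\bar v)\le\rho(\bar v)\le\tilde\rho(\bar v),\qquad(\ast)$$ and for all $\bar x\in\operatorname{dom}(f_0+g\circ F)$ $$\partial(f_0+g\circ F)(\bar x)\supseteq\bigcup_{\bar y\in\partial g(F(\bar x))}\partial(f_0+\langle\bar y,F\rangle)(\bar x)\supseteq\partial f_0(\bar x)+\bigcup_{\bar y\in\partial g(F(\bar x))}\partial\langle\bar y,F\rangle(\bar x).\qquad(\ast\ast)$$ Moreover, equality holds throughout $(\ast)$ and $(\ast\ast)$ if additionally $f\in\Gamma_0(\mathbb{R}^n\times\mathbb{R}^m)$, $$\operatorname{rint}(\operatorname{dom}(f_0))\cap\operatorname{rint}(\operatorname{dom}(F))\neq\emptyset,$$ and either $0\in\operatorname{rint}(U)$, or $0\in U$ and $f$ is piecewise linear-quadratic.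
   Context: $\overline{\mathbb{R}}=\mathbb{R}\cup\{-\infty,+\infty\}$; sums of opposite infinities follow the convention $(+\infty)+(-\infty)=+\infty$. For $h:\mathbb{R}^p\to\overline{\mathbb{R}}$: $\operatorname{dom}(h)=\{x:h(x)<+\infty\}$, $\operatorname{epi}(h)=\{(x,\alpha)\in\mathbb{R}^p\times\mathbb{R}:h(x)\le\alpha\}$, $h^*(v)=\sup_{x}\{\langle v,x\rangle-h(x)\}$. $h$ is convex (closed) if $\operatorname{epi}(h)$ is convex (closed), and proper if $h\not\equiv+\infty$ and $h>-\infty$ everywhere. $\Gamma(\mathbb{R}^p)$ is the set of proper convex functions $\mathbb{R}^p\to\overline{\mathbb{R}}$, and $\Gamma_0(\mathbb{R}^p)$ the set of closed functions in $\Gamma(\mathbb{R}^p)$. For convex $h$, $\partial h(\bar x)=\{v:h(x)\ge h(\bar x)+\langle v,x-\bar x\rangle\ \forall x\}$ if $h(\bar x)\in\mathbb{R}$, and $\partial h(\bar x)=\emptyset$ otherwise. Sums of sets are Minkowski sums. $\operatorname{rint}$ denotes relative interior. $+\infty_\bullet$ is an extra ''infinite element'' adjoined to $\mathbb{R}^m$; for $F:\mathbb{R}^n\to\mathbb{R}^m\cup\{+\infty_\bullet\}$, $\operatorname{dom}(F)=\{x:F(x)\neq+\infty_\bullet\}$. A function $h:\mathbb{R}^p\to\mathbb{R}\cup\{+\infty\}$ is piecewise linear-quadratic if there are a finite index set $I$ and, for each $i\in I$, a polyhedron $P_i\subseteq\mathbb{R}^p$, $A^i\in\mathbb{R}^{p\times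 p}$, $q^i\in\mathbb{R}^p$, $u_i\in\mathbb{R}$ such that $h(x)=\frac12\langle x,A^ix\rangle+\langle q^i,x\rangle-u_i$ for $x\in P_i$, $i\in I$, and $h(x)=+\infty$ for $x\notin\bigcup_{i\in I}P_i$. *)

(* Defs.v *)
From HB Require Import structures.
From mathcomp Require Import all_boot all_order all_algebra.
From mathcomp Require Import all_classical all_reals all_analysis.

Set Implicit Arguments.
Unset Strict Implicit.
Unset Printing Implicit Defensive.

Import Order.TTheory GRing.Theory Num.Theory.
Import numFieldNormedType.Exports.

Local Open Scope classical_set_scope.
Local Open Scope ring_scope.

(* R^p is 'rV[R]_p, and R^n x R^m is identified with 'rV[R]_(n + m) through
   row_mx, lsubmx and rsubmx.  Sums of extended reals that may involve opposite
   infinities use the dual addition (_ + _)%dE, for which +oo + -oo = +oo. *)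

Section ConvexAnalysis.
Context {R : realType} {p : nat}.
Implicit Types (h k : 'rV[R]_p -> \bar R) (A : set 'rV[R]_p).

Definition dotp (x y : 'rV[R]_p) : R := \sum_i x ord0 i * y ord0 i.

Definition edom h : set 'rV[R]_p := [set x | (h x < +oo)%E].

Definition epi h : set ('rV[R]_p * R^o) := [set xa | (h xa.1 <= xa.2%:E)%E].

Definition conjugate h (v : 'rV[R]_p) : \bar R :=
  ereal_sup [set ((dotp v x)%:E - h x)%E | x in setT].

Definition convex_fun h : Prop := convex_set (epi h).

Definition closed_fun h : Prop := closed (epi h).

Definition proper_fun h : Prop :=
  (exists x, h x <> +oo%E) /\ (forall x, (-oo < h x)%E).

Definition Gamma h : Prop := proper_fun h /\ convex_fun h.

Definition Gamma0 h : Prop := Gamma h /\ closed_fun h.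

Definition subdiff h (xb : 'rV[R]_p) : set 'rV[R]_p :=
  [set v | h xb \is a fin_num /\
           forall x, (h xb + (dotp v (x - xb))%:E <= h x)%E].

Definition fun_dadde h k : 'rV[R]_p -> \bar R := fun x => (h x + k x)%dE.

Definition affine_set A : Prop :=
  forall (t : R) x y, A x -> A y -> A ((1 - t) *: x + t *: y).

Definition affine_hull A : set 'rV[R]_p := smallest affine_set A.

Definition rint A : set 'rV[R]_p :=
  [set x | A x /\ \forall z \near x, affine_hull A z -> A z].

Definition polyhedron A : Prop :=
  exists (k : nat) (c : 'I_k -> 'rV[R]_p) (d : 'I_k -> R),
    A = [set x | forall j, dotp (c j) x <= d j].

Definition piecewise_linear_quadratic h : Prop :=
  exists (I : finType) (P : I -> set 'rV[R]_p) (A : I -> 'M[R]_p)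
         (q : I -> 'rV[R]_p) (u : I -> R),
  [/\ forall i, polyhedron (P i),
      (* x *m (A i)^T is the column A^i x written as a row *)
      forall i x, P i x ->
        h x = (2^-1 * dotp x (x *m (A i)^T) + dotp (q i) x - u i)%:E
    & forall x, ~ (\bigcup_i P i) x -> h x = +oo%E].

End ConvexAnalysis.

Section MinkowskiSum.
Context {R : realType} {p : nat}.
Implicit Types A B : set 'rV[R]_p.

Definition mink_add A B : set 'rV[R]_p := [set a + b | a in A & b in B].

Definition mink_sub A B : set 'rV[R]_p := [set a - b | a in A & b in B].

End MinkowskiSum.

Section Composite.
Context {R : realType} {n m : nat}.
(* None plays the role of the infinite element adjoined to R^m. *)
Variables (f0 : 'rV[R]_n -> \bar R) (F : 'rV[R]_n -> option 'rV[R]_m)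
          (g : 'rV[R]_m -> \bar R).

Definition vdom : set 'rV[R]_n := [set x | F x <> None].

Definition scalarize (y : 'rV[R]_m) : 'rV[R]_n -> \bar R :=
  fun x => if F x is Some w then (dotp y w)%:E else +oo%E.

Definition composite : 'rV[R]_n -> \bar R :=
  fun x => if F x is Some w then (f0 x + g w)%dE else +oo%E.

Definition perturbation : 'rV[R]_(n + m) -> \bar R :=
  fun z => if F (lsubmx z) is Some w
           then (f0 (lsubmx z) + g (w + rsubmx z)%R)%dE else +oo%E.

Definition perturbation_g : 'rV[R]_(n + m) -> \bar R :=
  fun z => if F (lsubmx z) is Some w then g (w + rsubmx z) else +oo%E.

Definition perturbation_domain : set 'rV[R]_m :=
  mink_sub (edom g) (Some @^-1` (F @` (edom f0 `&` vdom))).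

Definition rho (v : 'rV[R]_n) : \bar R :=
  ereal_inf [set ((conjugate (fun_dadde f0 (scalarize y)) v
                  + conjugate g y)%dE : \bar R) | y in setT].

Definition rho_tilde (v : 'rV[R]_n) : \bar R :=
  ereal_inf [set ((conjugate f0 w + conjugate (scalarize y) (v - w)%R
                  + conjugate g y)%dE : \bar R) | y in setT & w in setT].

End Composite.

(* Main.v *)
Require Import Defs.
From mathcomp Require Import all_boot all_order all_algebra.
From mathcomp Require Import all_classical all_reals all_analysis.
From mathcomp Require Import ring lra.

Import Order.TTheory GRing.Theory Num.Theory.
Import numFieldNormedType.Exports.

Local Open Scope classical_set_scope.
Local Open Scope ring_scope.

(* The primal value p(u) = inf_x (f(x, u) - <v, x>) is convex with domain U, and
   a subgradient y of p at 0 is a multiplier: it splits the conjugate of the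
   composite into the two terms of rho, and at a point where v is a subgradient
   of the composite it gives y in the subdifferential of g. If 0 is in rint U, y
   exists by a finite-dimensional Hahn-Banach argument. If f is piecewise
   linear-quadratic, the infimum p(0) is attained (Frank-Wolfe) at some z0, and y
   comes from Farkas' lemma applied to the tangent cones at z0 of the pieces.
   The step from rho to rho_tilde is the same duality with F the identity and
   g replaced by <y, F>. Extended reals are handled throughout by their real
   upper bounds, which makes all conventions on infinite sums disappear. *)

Section Dotp.
Context {R : realType} {p : nat}.
Implicit Types x y z : 'rV[R]_p.

Lemma dotpC x y : dotp x y = dotp y x.
Proof. by apply: eq_bigr => i _; rewrite mulrC. Qed.

Lemma dotpDr x y z : dotp x (y + z) = dotp x y + dotp x z.
Proof. by rewrite /dotp -big_split; apply: eq_bigr => i _; rewrite mxE mulrDr. Qed.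

Lemma dotpDl x y z : dotp (x + y) z = dotp x z + dotp y z.
Proof. by rewrite dotpC dotpDr !(dotpC z). Qed.

Lemma dotpZr t x y : dotp x (t *: y) = t * dotp x y.
Proof.
by rewrite /dotp mulr_sumr; apply: eq_bigr => i _; rewrite mxE mulrCA.
Qed.

Lemma dotpZl t x y : dotp (t *: x) y = t * dotp x y.
Proof. by rewrite dotpC dotpZr dotpC. Qed.

Lemma dotpNr x y : dotp x (- y) = - dotp x y.
Proof. by rewrite -scaleN1r dotpZr mulN1r. Qed.

Lemma dotpNl x y : dotp (- x) y = - dotp x y.
Proof. by rewrite dotpC dotpNr dotpC. Qed.

Lemma dotpBr x y z : dotp x (y - z) = dotp x y - dotp x z.
Proof. by rewrite dotpDr dotpNr. Qed.

Lemma dotpBl x y z : dotp (x - y) z = dotp x z - dotp y z.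
Proof. by rewrite dotpDl dotpNl. Qed.

Lemma dotp0 x : dotp x 0 = 0.
Proof. by rewrite -(scale0r 0) dotpZr mul0r. Qed.

Lemma dot0p x : dotp 0 x = 0.
Proof. by rewrite dotpC dotp0. Qed.

Lemma dotp_delta x i : dotp (delta_mx 0 i) x = x 0 i.
Proof.
rewrite /dotp (bigD1 i) //= mxE !eqxx mul1r big1 ?addr0 // => j ji.
by rewrite mxE (negbTE ji) andbF mul0r.
Qed.

Lemma dotp_mx x y : dotp x y = (x *m y^T) 0 0.
Proof. by rewrite mxE; apply: eq_bigr => i _; rewrite mxE. Qed.

End Dotp.

Lemma dotp_mulmx (R : realType) p q (M : 'M[R]_(q, p)) (w : 'rV[R]_q) (y : 'rV[R]_p) :
  dotp (w *m M) y = dotp w (y *m M^T).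
Proof. by rewrite !dotp_mx trmx_mul trmxK mulmxA. Qed.

Lemma dotp_row_mx (R : realType) n m (x x' : 'rV[R]_n) (u u' : 'rV[R]_m) :
  dotp (row_mx x u) (row_mx x' u') = dotp x x' + dotp u u'.
Proof.
rewrite /dotp big_split_ord; congr (_ + _); apply: eq_bigr => i _.
  by rewrite !row_mxEl.
by rewrite !row_mxEr.
Qed.

(* Hahn-Banach in dimension m, adding one coordinate at a time: the symmetry
   hypothesis says that 0 is in the relative interior of the projection of K. *)
Lemma convex_cone_support (R : realType) m (K : 'rV[R]_m -> R -> Prop) :
  (forall u v a b, K u a -> K v b -> K (u + v) (a + b)) ->
  (forall t u a, 0 < t -> K u a -> K (t *: u) (t * a)) ->
  (forall a, K 0 a -> 0 <= a) ->
  (forall u a, K u a -> exists b, K (- u) b) ->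
  exists y : 'rV[R]_m, forall u a, K u a -> dotp y u <= a.
Proof.
move=> KD KZ K0 KN.
suff H k : (k <= m)%N -> exists y : 'rV[R]_m, forall (u : 'rV[R]_m) a,
    (forall i : 'I_m, (k <= i)%N -> u 0 i = 0) -> K u a -> dotp y u <= a.
  have [y Hy] := H m (leqnn m); exists y => u a; apply: Hy => i.
  by rewrite leqNgt ltn_ord.
elim: k => [_|k IHk km].
  exists 0 => u a u0; rewrite dot0p (_ : u = 0); first exact: K0.
  by apply/rowP => i; rewrite mxE u0.
have [y Hy] := IHk (ltnW km); pose ik := Ordinal km.
pose low (u : 'rV[R]_m) := forall i : 'I_m, (k < i)%N -> u 0 i = 0.
pose e : 'rV[R]_m := delta_mx 0 ik.
pose S : set R := [set s | exists u a, [/\ low u, u 0 ik = -1, K u a & s = dotp y u - a]].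
have scal u a : low u -> u 0 ik != 0 -> K u a ->
    [/\ low (`|u 0 ik|^-1 *: u), (`|u 0 ik|^-1 *: u) 0 ik = Num.sg (u 0 ik)
      & K (`|u 0 ik|^-1 *: u) (`|u 0 ik|^-1 * a)].
  move=> lu u0 Ku; split; last by apply: KZ; rewrite // invr_gt0 normr_gt0.
    by move=> i ki; rewrite mxE (lu i) // mulr0.
  by rewrite mxE {2}[u 0 ik]numEsg mulrCA mulVf ?normr_eq0 // mulr1.
have bnd u a v b : low u -> low v -> u 0 ik = -1 -> v 0 ik = 1 ->
    K u a -> K v b -> dotp y u - a <= b - dotp y v.
  move=> lu lv u1 v1 Ku Kv.
  have := Hy (u + v) (a + b) _ (KD _ _ _ _ Ku Kv).
  rewrite dotpDr => uv; suff : dotp y u + dotp y v <= a + b by move=> ?; lra.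
  apply: uv => i; rewrite leq_eqVlt => /orP[/eqP ki|ki]; last first.
    by rewrite mxE lu // lv // addr0.
  by rewrite (_ : i = ik) ?mxE ?u1 ?v1 ?addNr //; exact/val_inj.
have lowN u : low u -> low (- u) by move=> lu i ki; rewrite mxE lu // oppr0.
have [S0|S0] := pselect (S !=set0); last first.
  exists y => u a lu Ku; apply: Hy => // i.
  rewrite leq_eqVlt => /orP[/eqP ki|ki]; last exact: lu.
  rewrite (_ : i = ik); last exact/val_inj.
  apply/eqP; apply: contra_notT S0 => uk0.
  have [b Kb] := KN _ _ Ku.
  have [ul1 uk1 Kul] := scal _ _ lu uk0 Ku.
  have nuk0 : (- u) 0 ik != 0 by rewrite mxE oppr_eq0.
  have [vl1 vk1 Kvl] := scal _ _ (lowN _ lu) nuk0 Kb.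
  have [u_gt0|u_le0] := ltrP 0 (u 0 ik).
    exists (dotp y (`|(- u) 0 ik|^-1 *: (- u)) - `|(- u) 0 ik|^-1 * b).
    exists (`|(- u) 0 ik|^-1 *: (- u)), (`|(- u) 0 ik|^-1 * b); split => //.
    by rewrite vk1 mxE sgrN gtr0_sg.
  exists (dotp y (`|u 0 ik|^-1 *: u) - `|u 0 ik|^-1 * a).
  exists (`|u 0 ik|^-1 *: u), (`|u 0 ik|^-1 * a); split => //.
  by rewrite uk1 ltr0_sg // lt_neqAle uk0.
have [s0 [u0 [a0 [lu0 u01 Ku0 s0E]]]] := S0.
have [b0 Kb0] := KN _ _ Ku0.
have Sub : ubound S (b0 - dotp y (- u0)).
  move=> _ [u [a [lu u1 Ku ->]]]; apply: bnd => //; first exact: lowN.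
  by rewrite mxE u01 opprK.
have HS : has_sup S by split => //; exists (b0 - dotp y (- u0)).
exists (y + sup S *: e) => u a lu Ku.
rewrite dotpDl dotpZl dotp_delta.
have [uk0|uk0] := eqVneq (u 0 ik) 0.
  rewrite uk0 mulr0 addr0; apply: Hy => // i.
  rewrite leq_eqVlt => /orP[/eqP ki|ki]; last exact: lu.
  by rewrite (_ : i = ik) //; exact/val_inj.
have [ul1 uk1 Kul] := scal _ _ lu uk0 Ku.
have n0 : 0 < `|u 0 ik| by rewrite normr_gt0.
rewrite -(ler_pM2l (_ : 0 < `|u 0 ik|^-1)) ?invr_gt0 //.
have [u_gt0|u_le0] := ltrP 0 (u 0 ik).
  have : sup S <= `|u 0 ik|^-1 * a - dotp y (`|u 0 ik|^-1 *: u).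
    apply: ge_sup => // _ [v [b [lv v1 Kv ->]]].
    by apply: bnd; rewrite // uk1 gtr0_sg.
  rewrite dotpZr mulrDr (mulrCA _ (sup S)) (gtr0_norm u_gt0) mulVf ?gt_eqF //.
  by move=> ?; lra.
have u_lt0 : u 0 ik < 0 by rewrite lt_neqAle uk0.
have : dotp y (`|u 0 ik|^-1 *: u) - `|u 0 ik|^-1 * a <= sup S.
  apply: ub_le_sup; first by case: HS.
  exists (`|u 0 ik|^-1 *: u), (`|u 0 ik|^-1 * a); split => //.
  by rewrite uk1 ltr0_sg.
rewrite dotpZr mulrDr (mulrCA _ (sup S)) (ltr0_norm u_lt0) invrN mulNr.
rewrite (mulNr _ (u 0 ik)) mulVf // => ?; lra.
Qed.

Section Farkas.
Context {R : realType} {V : lmodType R}.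
Implicit Types (a b : V -> R) (x : V).

Definition linear_form a := forall t x y, a (t *: x + y) = t * a x + a y.

(* Farkas' lemma with equality constraints e x = 0, in which only the
   multiplier of e is kept; following D. Bartl, induct on the inequalities. *)
Lemma farkas_multiplier m (e : V -> 'rV[R]_m) (T : eqType) (s : seq T)
    (a : T -> V -> R) b :
  (forall t x y, e (t *: x + y) = t *: e x + e y) ->
  (forall j, linear_form (a j)) -> linear_form b ->
  (forall x, e x = 0 -> (forall j, j \in s -> a j x <= 0) -> b x <= 0) ->
  exists y, forall x, (forall j, j \in s -> a j x <= 0) -> b x <= dotp y (e x).
Proof.
move=> eL; elim: s a b => [|j s IHs] a b aL bL H.
  have form0 c : linear_form c -> c 0 = 0.
    by move=> cL; have := cL (-1) 0 0; rewrite scaler0 addr0 mulN1r addNr.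
  have formZ c t x : linear_form c -> c (t *: x) = t * c x.
    by move=> cL; rewrite -[t *: x]addr0 cL form0 // addr0.
  have e0 : e 0 = 0 by have := eL (-1) 0 0; rewrite scaler0 addr0 scaleN1r addNr.
  pose K u s := exists x, u = e x /\ s = - b x.
  have [||||y Hy] := @convex_cone_support R m K.
  - move=> _ _ _ _ [x [-> ->]] [z [-> ->]]; exists (1 *: x + z).
    by rewrite eL bL scale1r mul1r opprD.
  - move=> t _ _ _ [x [-> ->]]; exists (t *: x); rewrite formZ // mulrN.
    by rewrite -[t *: x]addr0 eL e0 addr0.
  - by move=> _ [x [ex0 ->]]; rewrite oppr_ge0; apply: H.
  - move=> _ _ [x [-> _]]; exists (- b (-1 *: x)), (-1 *: x); split=> //.
    by rewrite -[-1 *: x]addr0 eL e0 addr0 scaleN1r.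
  exists (- y) => x _; rewrite dotpNl lerNr.
  by apply: Hy; exists x.
have [Hs|/existsNP[x1 /not_implyP[ex1 /not_implyP[sx1 /negP bx1]]]] := pselect
    (forall x, e x = 0 -> (forall j, j \in s -> a j x <= 0) -> b x <= 0).
  have [y Hy] := IHs a b aL bL Hs; exists y => x Hx; apply: Hy => i si.
  by apply: Hx; rewrite in_cons si orbT.
rewrite -ltNge in bx1.
have ax1 : 0 < a j x1.
  rewrite ltNge; apply/negP => ajx1; move: bx1; rewrite ltNge => /negP; apply.
  by apply: H => // i; rewrite in_cons => /predU1P[->//|/sx1].
pose pr x := - (a j x / a j x1) *: x1 + x.
have prL t x z : pr (t *: x + z) = t *: pr x + pr z.
  rewrite /pr aL scalerDr scalerA addrACA -scalerDl; congr (_ *: _ + _).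
  by rewrite mulrDl; ring.
have pr_a c : linear_form c -> linear_form (c \o pr).
  by move=> cL t x z /=; rewrite prL cL.
have [|y Hy] := IHs (fun i => a i \o pr) (b \o pr) (fun i => pr_a _ (aL i)) (pr_a _ bL).
  move=> x ex sx /=; apply: H.
    by rewrite /pr eL ex1 ex scaler0 addr0.
  move=> i; rewrite in_cons => /predU1P[->|/sx//].
  by rewrite /pr aL mulNr divfK ?addNr // gt_eqF.
exists y => x sx.
have aj : 0 <= - (a j x / a j x1).
  rewrite oppr_ge0 pmulr_lle0 ?invr_gt0 //; apply: sx.
  by rewrite mem_head.
apply: le_trans (Hy x _) => /=.
  by rewrite /pr bL lerDr mulr_ge0 // ltW.
move=> i si; rewrite /pr aL; have := sx1 _ si.
have := sx i; rewrite in_cons si orbT => /(_ isT) => h1 h2.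
by rewrite -(addr0 0) lerD // mulr_ge0_le0.
Qed.

End Farkas.

Section Quadratic.
Context {R : realType} {k : nat}.
Implicit Types (A K : 'M[R]_k) (b x d : 'rV[R]_k) (c t : R).

Definition qform A d : R := dotp d (d *m A).

Definition quad A b c x : R := qform A x + dotp b x + c.

Definition dquad A b x d : R := dotp d (x *m (A + A^T) + b).

Lemma qformZ A t d : qform A (t *: d) = t ^+ 2 * qform A d.
Proof. by rewrite /qform -scalemxAl dotpZl dotpZr mulrA expr2. Qed.

Lemma quad_line A b c x t d :
  quad A b c (x + t *: d) = quad A b c x + t * dquad A b x d + t ^+ 2 * qform A d.
Proof.
rewrite /quad /dquad /qform mulmxDl mulmxDr !dotpDl !dotpDr -!scalemxAl.
rewrite !dotpZl !dotpZr (dotpC d b) (dotpC d (x *m A^T)) dotp_mulmx trmxK.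
by ring.
Qed.

Lemma quadD A b c x d :
  quad A b c (x + d) = quad A b c x + dquad A b x d + qform A d.
Proof. by rewrite -[d in LHS]scale1r quad_line expr1n !mul1r. Qed.

Lemma quad_min_affine A b c x0 K lo :
  (forall d, (d <= K)%MS -> 0 <= qform A d) ->
  (forall x, (x - x0 <= K)%MS -> lo <= quad A b c x) ->
  exists2 x, (x - x0 <= K)%MS &
    forall z, (z - x0 <= K)%MS -> quad A b c x <= quad A b c z.
Proof.
move=> psd Hlo; pose B := A + A^T.
pose M := K *m B *m K^T; pose r := (x0 *m B + b) *m K^T.
have dE w y : dquad A b (x0 + w *m K) (y *m K) = dotp y (w *m M + r).
  rewrite /dquad dotp_mulmx -/B; congr dotp.
  by rewrite /r /M !mulmxDl !mulmxA addrAC addrC.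
have [/submxP[w rE]|rM] := boolP (r <= M)%MS.
  exists (x0 + (- w) *m K); first by rewrite addrC addKr submxMl.
  move=> z /submxP[y zE].
  have -> : z = x0 + (- w) *m K + (y + w) *m K.
    by rewrite mulNmx mulmxDl -zE addrACA addNr addr0 addrC subrK.
  by rewrite (quadD _ _ _ (x0 + - w *m K)) dE rE !mulNmx addNr dotp0 addr0 lerDl psd // submxMl.
have /rV0Pn[i ri] : r *m cokermx M != 0 by rewrite -submxE.
pose y := (col i (cokermx M))^T.
have My : M *m y^T = 0 by rewrite trmxK colE mulmxA mulmx_coker mul0mx.
have ry : dotp y r != 0.
  by rewrite dotpC dotp_mx trmxK colE mulmxA -colE mxE.
have qy : qform A (y *m K) = 0.
  have : dotp (y *m M) y = 0 by rewrite dotp_mx -mulmxA My mulmx0 mxE.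
  rewrite dotpC /M /B !mulmxA -dotp_mulmx mulmxDr dotpDr.
  rewrite -[dotp _ (_ *m A^T)]dotp_mulmx [dotp (_ *m A) _]dotpC => /eqP.
  by rewrite -mulr2n mulrn_eq0 => /eqP.
have := Hlo (x0 + ((lo - quad A b c x0 - 1) / dotp y r) *: (y *m K)).
rewrite addrC addKr scalemx_sub ?submxMl // => /(_ isT).
rewrite quad_line -[x0 in dquad _ _ x0]addr0 -(mul0mx _ K) dE mul0mx add0r.
by rewrite divfK // qy mulr0 addr0 -lerBlDl lerDl oppr_ge0 ler10.
Qed.

Definition feasible x0 K (s : seq ('rV[R]_k * R)) x : Prop :=
  (x - x0 <= K)%MS /\ forall cd, cd \in s -> dotp cd.1 x <= cd.2.

Lemma feasible_line x0 K s x z t : 0 <= t <= 1 ->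
  feasible x0 K s x -> feasible x0 K s z -> feasible x0 K s (x + t *: (z - x)).
Proof.
move=> /andP[t0 t1] [xK sx] [zK sz]; split.
  have -> : x + t *: (z - x) - x0 = (1 - t) *: (x - x0) + t *: (z - x0).
    by apply/rowP => i; rewrite !mxE; ring.
  by rewrite addmx_sub // scalemx_sub.
move=> cd scd; rewrite dotpDr dotpZr dotpBr.
have -> : dotp cd.1 x + t * (dotp cd.1 z - dotp cd.1 x) =
    (1 - t) * dotp cd.1 x + t * dotp cd.1 z by ring.
have -> : cd.2 = (1 - t) * cd.2 + t * cd.2 by ring.
by rewrite lerD // ler_wpM2l ?subr_ge0 // ?sx ?sz.
Qed.

(* The Frank-Wolfe theorem in the convex case. Either the last inequality can
   be dropped, or the minimum is attained where it is an equality. *)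
Lemma quad_min_polyhedron A b c s x0 K lo :
  (exists x, feasible x0 K s x) ->
  (forall x z, feasible x0 K s x -> feasible x0 K s z -> 0 <= qform A (z - x)) ->
  (forall x, feasible x0 K s x -> lo <= quad A b c x) ->
  exists2 x, feasible x0 K s x &
    forall z, feasible x0 K s z -> quad A b c x <= quad A b c z.
Proof.
elim: s x0 K lo => [|[c1 d1] s IHs] x0 K lo [x xf] psd Hlo.
  have [d dK|z zK|x' x'K x'min] := @quad_min_affine A b c x0 K lo.
  - have : feasible x0 K [::] (x0 + d) by split=> //; rewrite addrC addKr.
    move=> /(psd x0 _); rewrite addrC addKr; apply.
    by split; rewrite ?subrr ?sub0mx.
  - by apply: Hlo; split.
  - by exists x' => [|z [zK _]]; [split | apply: x'min].
have consP y : feasible x0 K ((c1, d1) :: s) y <->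
    feasible x0 K s y /\ dotp c1 y <= d1.
  split=> [[yK sy]|[[yK sy] y1]].
    split; last by apply: (sy (c1, d1)); rewrite mem_head.
    by split=> // cd scd; apply: sy; rewrite in_cons scd orbT.
  by split=> // cd; rewrite in_cons => /predU1P[->//|/sy].
have [[x1 [/consP[x1f]]]|noP] := pselect (exists x,
    feasible x0 K ((c1, d1) :: s) x /\
    forall y, feasible x0 K s y -> dotp c1 y = d1 -> quad A b c x < quad A b c y).
  rewrite le_eqVlt => /orP[/eqP x1E /(_ _ x1f x1E)|x1lt x1min].
    by rewrite ltxx.
  have psd' z z' : feasible x0 K s z -> feasible x0 K s z' -> 0 <= qform A (z' - z).
    move=> zf z'f; pose a := dotp c1 (z - x1); pose a' := dotp c1 (z' - x1).
    pose dl := d1 - dotp c1 x1; have dl0 : 0 < dl by rewrite subr_gt0.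
    have n0 : 0 < dl + `|a| + `|a'| by rewrite -addrA ltr_wpDr // addr_ge0.
    pose t := dl / (dl + `|a| + `|a'|).
    have t0 : 0 < t by rewrite divr_gt0.
    have t1 : t <= 1.
      by rewrite ler_pdivrMr // mul1r -addrA lerDl addr_ge0.
    have feas w : feasible x0 K s w -> dotp c1 (w - x1) <= dl + `|a| + `|a'| ->
        feasible x0 K ((c1, d1) :: s) (x1 + t *: (w - x1)).
      move=> wf wa; apply/consP; split; first by apply: feasible_line => //; rewrite ltW.
      rewrite dotpDr dotpZr -lerBrDl -/dl /t mulrAC ler_pdivrMr //.
      by rewrite ler_wpM2l // ltW.
    have := psd _ _ (feas z zf _) (feas z' z'f _).
    have -> : x1 + t *: (z' - x1) - (x1 + t *: (z - x1)) = t *: (z' - z).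
      by apply/rowP => i; rewrite !mxE; ring.
    have na := ler_norm a; have na' := ler_norm a'.
    have pa := normr_ge0 a; have pa' := normr_ge0 a'.
    rewrite qformZ pmulr_rge0 ?exprn_gt0 //; apply.
      by rewrite -/a; lra.
    by rewrite -/a'; lra.
  have out z : feasible x0 K s z -> d1 < dotp c1 z -> quad A b c x1 < quad A b c z.
    move=> zf z1; have n0 : 0 < dotp c1 z - dotp c1 x1 by lra.
    pose t := (d1 - dotp c1 x1) / (dotp c1 z - dotp c1 x1).
    have t0 : 0 < t by rewrite divr_gt0 // subr_gt0.
    have t1 : t < 1 by rewrite ltr_pdivrMr // mul1r ltrD2r.
    have := x1min (x1 + t *: (z - x1)) _ _.
    rewrite quad_line dotpDr dotpZr dotpBr divfK ?gt_eqF // addrCA subrr addr0.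
    have : feasible x0 K s (x1 + t *: (z - x1)) by apply: feasible_line; rewrite ?ltW.
    move=> /[swap] /[apply] /(_ erefl).
    have Q0 := psd' _ _ x1f zf.
    have -> : quad A b c z = quad A b c (x1 + (z - x1)) by rewrite addrC subrK.
    rewrite quadD -addrA ltrDl -addrA ltrDl.
    rewrite expr2 -mulrA -mulrDr pmulr_rgt0 // => D0.
    by apply: lt_le_trans D0 _; rewrite lerD2l ler_piMl // ltW.
  have lo1 : lo <= quad A b c x1 by apply/Hlo/consP; split=> //; exact: ltW.
  have [||z zf zmin] := IHs x0 K lo _ psd'; first by exists x1.
    move=> z zf; have [z1|z1] := leP (dotp c1 z) d1; first by apply/Hlo/consP.
    by apply: le_trans lo1 (ltW (out _ zf z1)).
  exists z => [|w /consP[wf _]]; last exact: zmin.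
  apply/consP; split=> //; rewrite leNgt; apply/negP => /(out _ zf).
  by rewrite ltNge zmin.
have face y : feasible x0 K ((c1, d1) :: s) y ->
    exists z, [/\ feasible x0 K s z, dotp c1 z = d1 & quad A b c z <= quad A b c y].
  move=> yf; apply/not_existsP => H; apply: noP; exists y; split=> // z zf z1.
  by rewrite ltNge; apply/negP => zy; apply: (H z).
have [x1 [x1f x1E _]] := face x xf.
pose K1 := (K :&: kermx c1^T)%MS.
have faceP y : feasible x1 K1 s y <-> feasible x0 K s y /\ dotp c1 y = d1.
  have kerE : (y - x1 <= kermx c1^T)%MS = (dotp c1 y == d1).
    have : dotp c1 y - d1 = ((y - x1) *m c1^T) 0 0.
      by rewrite -dotp_mx dotpBl !(dotpC _ c1) x1E.
    rewrite -subr_eq0 => ->; apply/sub_kermxP/eqP => [->|y0]; first by rewrite mxE.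
    by apply/matrixP => i j; rewrite !ord1 y0 mxE.
  have KE : (y - x1 <= K)%MS = (y - x0 <= K)%MS.
    case: x1f => x1K _; apply/idP/idP => yK.
      by rewrite -(subrK x1 y) -addrA addmx_sub.
    have -> : y - x1 = (y - x0) - (x1 - x0) by apply/rowP => i; rewrite !mxE; ring.
    by rewrite addmx_sub // eqmx_opp.
  rewrite /feasible sub_capmx kerE KE; split.
    by case=> /andP[yK /eqP y1] sy.
  by case=> -[yK sy] /eqP y1; rewrite yK y1.
have consF y : feasible x1 K1 s y -> feasible x0 K ((c1, d1) :: s) y.
  by move=> /faceP[yf y1]; apply/consP; rewrite y1.
have [|||z /faceP[zf z1] zmin] := IHs x1 K1 lo.
- by exists x1; apply/faceP.
- by move=> y z /consF yf /consF zf; apply: psd.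
- by move=> y /consF; apply: Hlo.
exists z => [|y /face[w [wf w1 wy]]]; first by apply/consP; rewrite z1.
by apply: le_trans wy; apply: zmin; apply/faceP.
Qed.

End Quadratic.

Lemma convex_funP (R : realType) p (h : 'rV[R]_p -> \bar R) :
  convex_fun h <-> forall (x y : 'rV[R]_p) (r s t : R), 0 <= t <= 1 ->
    (h x <= r%:E)%E -> (h y <= s%:E)%E ->
    (h (t *: x + (1 - t) *: y)%R <= (t * r + (1 - t) * s)%:E)%E.
Proof.
split=> [hc x y r s t /andP[t0 t1] hx hy|hc [x r] [y s] t].
  have := hc (x, r : R^o) (y, s : R^o) (Itv01 t0 t1).
  by rewrite !inE; apply.
rewrite !inE /epi /= => hx hy.
by apply: (hc _ _ _ _ t%:num) => //; apply/andP; split; [exact: ge0 | exact: le1].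
Qed.

Lemma multiplier_rint (R : realType) n m (f : 'rV[R]_(n + m) -> \bar R) v a :
  convex_fun f ->
  (forall x r, (f (row_mx x 0) <= r%:E)%E -> a + dotp v x <= r) ->
  (forall x u r, (f (row_mx x u) <= r%:E)%E -> exists2 t, 0 < t &
     exists x' r', (f (row_mx x' (- t *: u)) <= r'%:E)%E) ->
  exists y : 'rV[R]_m, forall x u r, (f (row_mx x u) <= r%:E)%E ->
    a + dotp v x + dotp y u <= r.
Proof.
move=> /convex_funP fc f0 fN.
pose K (u : 'rV[R]_m) s := exists t x u' r,
  [/\ 0 < t, (f (row_mx x u') <= r%:E)%E, u = t *: u' & s = t * (r - a - dotp v x)].
have [||||y Hy] := @convex_cone_support R m K.
- move=> _ _ _ _ [t1 [x1 [u1 [r1 [t10 f1 -> ->]]]]] [t2 [x2 [u2 [r2 [t20 f2 -> ->]]]]].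
  have T0 : t1 + t2 != 0 by rewrite gt_eqF // addr_gt0.
  pose l := t1 / (t1 + t2); have El : 1 - l = t2 / (t1 + t2).
    by rewrite /l -{1}(divff T0) -mulrBl addrC addKr.
  have l01 : 0 <= l <= 1.
    by rewrite -(subr_ge0 l) El !divr_ge0 // ?addr_ge0 // ltW.
  exists (t1 + t2), (l *: x1 + (1 - l) *: x2), (l *: u1 + (1 - l) *: u2).
  exists (l * r1 + (1 - l) * r2); split.
  + by rewrite addr_gt0.
  + have := fc _ _ _ _ _ l01 f1 f2.
    by rewrite !scale_row_mx add_row_mx.
  + by rewrite El scalerDr !scalerA ![(t1 + t2) * _]mulrC !divfK.
  + rewrite El dotpDr !dotpZr /l; field.
    exact: T0.
- move=> t _ _ t0 [t1 [x1 [u1 [r1 [t10 f1 -> ->]]]]].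
  exists (t * t1), x1, u1, r1; split=> //; first by rewrite mulr_gt0.
    by rewrite scalerA.
  by rewrite mulrA.
- move=> b [t [x [u' [r [t0 fx /esym/eqP]]]]].
  rewrite scaler_eq0 gt_eqF //= => /eqP u0 ->.
  rewrite pmulr_rge0 //; move: fx; rewrite u0 => /f0.
  by rewrite -addrA -opprD subr_ge0.
- move=> u b [t [x [u' [r [t0 fx -> _]]]]].
  have [t1 t10 [x1 [r1 f1]]] := fN _ _ _ fx.
  exists (t / t1 * (r1 - a - dotp v x1)), (t / t1), x1, (- t1 *: u'), r1.
  split=> //; first by rewrite divr_gt0.
  by rewrite scalerA mulrN divfK ?gt_eqF // scaleNr.
exists y => x u r fx.
have : dotp y u <= r - a - dotp v x; last by lra.
by apply: Hy; exists 1, x, u, r; rewrite scale1r mul1r.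
Qed.

Lemma small_step (R : realType) (T : eqType) (s : seq T) (a b : T -> R) :
  (forall j, j \in s -> a j < 0 \/ (a j <= 0 /\ b j <= 0)) ->
  exists2 e, 0 < e & forall t, 0 < t -> t <= e ->
    forall j, j \in s -> a j + t * b j <= 0.
Proof.
elim: s => [|j s IHs] H; first by exists 1.
have [|e e0 He] := IHs; first by move=> i si; apply: H; rewrite in_cons si orbT.
have b1 : 0 < 1 + `|b j| by rewrite ltr_wpDr.
have [aj|[aj bj]] := H j (mem_head _ _); last first.
  exists e => // t t0 te i; rewrite in_cons => /predU1P[->|]; last exact: He.
  by rewrite -(addr0 0) lerD // mulr_ge0_le0 // ltW.
exists (Num.min e (- a j / (1 + `|b j|))) => [|t t0].
  by rewrite lt_min e0 divr_gt0 // oppr_gt0.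
rewrite le_min => /andP[te]; rewrite ler_pdivlMr // => tb i.
rewrite in_cons => /predU1P[->|]; last exact: He.
rewrite -lerBrDl sub0r; apply: le_trans tb; rewrite ler_pM2l //.
by apply: le_trans (ler_norm _) _; rewrite lerDr.
Qed.

Section PiecewiseQuadratic.
Context {R : realType} {k m : nat}.
Variables (D : 'rV[R]_k -> Prop) (phi : 'rV[R]_k -> R).
Variables (I : finType) (s : I -> seq ('rV[R]_k * R)).
Variables (A : I -> 'M[R]_k) (b : I -> 'rV[R]_k) (c : I -> R).
Variable (E : 'M[R]_(k, m)).

Let P i x := forall cd, cd \in s i -> dotp cd.1 x <= cd.2.
Let constraints := [seq (i, cd) | i <- enum I, cd <- s i].

Hypothesis domP : forall x, D x -> exists i, P i x.
Hypothesis pieceP : forall i x, P i x -> D x /\ phi x = quad (A i) (b i) (c i) x.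
Hypothesis phi_convex : forall x y t, 0 <= t <= 1 -> D x -> D y ->
  D (t *: x + (1 - t) *: y) /\
  phi (t *: x + (1 - t) *: y) <= t * phi x + (1 - t) * phi y.

Let mem_constraints i cd : cd \in s i -> (i, cd) \in constraints.
Proof.
by move=> h; apply/allpairsPdep; exists i, cd; split; rewrite ?mem_enum.
Qed.

Let piece_psd i x z : P i x -> P i z -> 0 <= qform (A i) (z - x).
Proof.
move=> Px Pz; have half : (1 - 2^-1 : R) = 2^-1 by lra.
have Pm : P i (x + 2^-1 *: (z - x)).
  move=> cd cs; rewrite dotpDr dotpZr dotpBr.
  by have := Px _ cs; have := Pz _ cs; lra.
have [_ Ex] := pieceP _ _ Px; have [_ Ez] := pieceP _ _ Pz; have [_ Em] := pieceP _ _ Pm.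
have h01 : 0 <= (2^-1 : R) <= 1 by lra.
have [_] := phi_convex _ _ _ h01 (pieceP _ _ Pz).1 (pieceP _ _ Px).1.
have -> : 2^-1 *: z + (1 - 2^-1) *: x = x + 2^-1 *: (z - x).
  by apply/rowP => j; rewrite !mxE; ring.
rewrite Em Ex; have -> : phi z = quad (A i) (b i) (c i) (x + (z - x)).
  by rewrite addrC subrK.
by rewrite quad_line quadD half; lra.
Qed.

Lemma plq_min lo : (exists2 x, D x & x *m E = 0) ->
  (forall x, D x -> x *m E = 0 -> lo <= phi x) ->
  exists z0, [/\ D z0, z0 *m E = 0 & forall z, D z -> z *m E = 0 -> phi z0 <= phi z].
Proof.
move=> [x Dx xE] Hlo; have [i0 Px] := domP _ Dx.
pose feas i := `[< exists2 x, P i x & x *m E = 0 >].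
have fP i z : feasible 0 (kermx E) (s i) z <-> P i z /\ z *m E = 0.
  rewrite /feasible subr0; split=> [[/sub_kermxP zE ?]|[? zE]]; first by split.
  by split=> //; apply/sub_kermxP.
have mini i : exists z, feas i ->
    [/\ P i z, z *m E = 0 & forall w, P i w -> w *m E = 0 -> phi z <= phi w].
  have [[y Py yE]|nf] := pselect (exists2 x, P i x & x *m E = 0); last first.
    by exists 0 => /asboolP.
  have [|||z /fP[Pz zE] zmin] := @quad_min_polyhedron R k (A i) (b i) (c i) (s i)
      0 (kermx E) lo.
  - by exists y; apply/fP.
  - by move=> x1 x2 /fP[P1 _] /fP[P2 _]; apply: piece_psd.
  - by move=> w /fP[Pw wE]; rewrite -(pieceP _ _ Pw).2; apply: Hlo => //; case: (pieceP _ _ Pw).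
  exists z => _; split=> // w Pw wE.
  by rewrite (pieceP _ _ Pz).2 (pieceP _ _ Pw).2; apply: zmin; apply/fP.
have [X HX] := choice mini.
have feas0 : feas i0 by apply/asboolP; exists x.
case: (@Order.TotalTheory.arg_minP _ _ _ i0 feas (phi \o X)) => //= i feasi imin.
have [Pi Ei Xmin] := HX i feasi.
exists (X i); split=> //; first by case: (pieceP _ _ Pi).
move=> z Dz zE; have [j Pz] := domP _ Dz.
have feasj : feas j by apply/asboolP; exists z.
by apply: le_trans (imin j feasj) _; have [_ _] := HX j feasj; apply.
Qed.

Lemma plq_multiplier : (exists2 x, D x & x *m E = 0) ->
  (forall x, D x -> x *m E = 0 -> 0 <= phi x) ->
  exists y, forall x, D x -> dotp y (x *m E) <= phi x.
Proof.
move=> De phi0; have [z0 [D0 E0 z0min]] := plq_min _ De phi0.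
have slack (p q r : R) : p + r <= q -> (q - p) / 2 - r <= 0 -> p <= q.
  by move=> *; lra.
have slope (p q r t u : R) : 0 <= u ->
    p + t * q + u <= t * r + (1 - t) * p -> t * q <= t * (r - p).
  by move=> *; lra.
pose act i := `[< P i z0 >].
pose g i d := dquad (A i) (b i) z0 d.
pose V := {ffun I -> 'rV[R]_k}.
pose tight := [seq icd <- constraints | dotp icd.2.1 z0 == icd.2.2].
pose a (icd : I * ('rV[R]_k * R)) (x : V) := dotp icd.2.1 (x icd.1).
pose bf (x : V) := - \sum_(i | act i) g i (x i).
pose e (x : V) := (\sum_(i | act i) x i) *m E.
(* Directional second-order upper bounds of phi at z0 form a convex cone. *)
pose K d r := exists t0 C, 0 < t0 /\ forall t, 0 < t -> t <= t0 ->
  D (z0 + t *: d) /\ phi (z0 + t *: d) <= phi z0 + t * r + t ^+ 2 * C.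
have K0 : K 0 0.
  by exists 1, 0; split=> // t _ _; rewrite scaler0 addr0 !mulr0 !addr0.
have KD d1 r1 d2 r2 : K d1 r1 -> K d2 r2 -> K (d1 + d2) (r1 + r2).
  move=> [t1 [C1 [t10 H1]]] [t2 [C2 [t20 H2]]].
  exists (Num.min t1 t2 / 2), (2 * (C1 + C2)); split.
    by rewrite divr_gt0 // lt_min t10.
  move=> t t_gt0; rewrite ler_pdivlMr // le_min => /andP[tt1 tt2].
  have t2_gt0 : 0 < t * 2 by rewrite mulr_gt0.
  have [D1 p1] := H1 _ t2_gt0 tt1; have [D2 p2] := H2 _ t2_gt0 tt2.
  have h01 : 0 <= (2^-1 : R) <= 1 by lra.
  have := phi_convex _ _ _ h01 D1 D2.
  have -> : 2^-1 *: (z0 + (t * 2) *: d1) + (1 - 2^-1) *: (z0 + (t * 2) *: d2) =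
      z0 + t *: (d1 + d2).
    by apply/rowP => j; rewrite !mxE; field.
  by move=> [? ph]; split=> //; apply: (le_trans ph); lra.
have Knn d r : K d r -> d *m E = 0 -> 0 <= r.
  move=> [t0 [C [t00 H]]] dE; rewrite leNgt; apply/negP => r0.
  have C1 : 0 < 1 + `|C| by rewrite ltr_wpDr.
  pose t := Num.min t0 (- r / (2 * (1 + `|C|))).
  have t_gt0 : 0 < t by rewrite lt_min t00 divr_gt0 // ?oppr_gt0 // mulr_gt0.
  have tt0 : t <= t0 by rewrite ge_min lexx.
  have : t <= - r / (2 * (1 + `|C|)) by rewrite ge_min lexx orbT.
  rewrite ler_pdivlMr ?mulr_gt0 // => tC.
  have [Dt pt] := H _ t_gt0 tt0.
  have zE : (z0 + t *: d) *m E = 0 by rewrite mulmxDl -scalemxAl dE E0 scaler0 addr0.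
  have /le_trans/(_ pt) := z0min _ Dt zE.
  rewrite -addrA lerDl expr2 -mulrA -mulrDr pmulr_rge0 // leNgt => /negP; apply.
  have : t * C <= t * `|C| by rewrite ler_pM2l // ler_norm.
  by move=> ?; lra.
have aL j : linear_form (a j).
  by move=> t x y; rewrite /a !ffunE dotpDr dotpZr.
have bL : linear_form bf.
  move=> t x y; rewrite /bf mulrN -opprD mulr_sumr -big_split; congr (- _).
  by apply: eq_bigr => i _; rewrite /g /dquad !ffunE dotpDl dotpZl.
have eL t x y : e (t *: x + y) = t *: e x + e y.
  rewrite /e scalemxAl -mulmxDl scaler_sumr -big_split; congr (_ *m _).
  by apply: eq_bigr => i _; rewrite !ffunE.
have [|y Hy] := @farkas_multiplier R V m e _ tight a bf eL aL bL.
  move=> x ex xs; rewrite oppr_le0; apply: Knn ex.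
  have [|t0 t00 Ht0] := @small_step R _ [seq icd <- constraints | act icd.1]
      (fun icd => dotp icd.2.1 z0 - icd.2.2) (a ^~ x).
    move=> [i cd]; rewrite mem_filter => /andP[/= /asboolP Pi icd].
    have cds : cd \in s i by case/allpairsPdep: icd => j [w [_ ws [-> ->]]].
    have := Pi _ cds; rewrite le_eqVlt => /orP[/eqP z0cd|]; last first.
      by rewrite -subr_lt0; left.
    right; rewrite z0cd subrr; split=> //; apply: (xs (i, cd)).
    by rewrite mem_filter /= z0cd eqxx.
  apply: (big_ind2 K K0 KD) => i acti; have /asboolP Pi := acti.
  exists t0, (qform (A i) (x i)); split=> // t t_gt0 tt0.
  have Pt : P i (z0 + t *: x i).
    move=> cd cds; have := Ht0 _ t_gt0 tt0 (i, cd).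
    rewrite mem_filter /= acti mem_constraints // => /(_ isT).
    by rewrite /a /= dotpDr dotpZr addrAC subr_le0.
  have [Dt ->] := pieceP _ _ Pt; split=> //.
  by rewrite (pieceP _ _ Pi).2 quad_line.
have yg i d : act i -> (forall cd, cd \in s i -> dotp cd.1 z0 = cd.2 ->
    dotp cd.1 d <= 0) -> dotp (- y) (d *m E) <= g i d.
  move=> acti di; pose x : V := [ffun j => if j == i then d else 0].
  have := Hy x _; rewrite /bf /e !(bigD1 i acti) /= ffunE eqxx !big1.
  - rewrite !addr0 dotpNl lerNl; apply=> -[j cd].
    rewrite mem_filter => /andP[/eqP /= z0cd icd]; rewrite /a ffunE /=.
    case: eqP icd => [->|_ _]; last by rewrite dotp0.
    by case/allpairsPdep => j' [w [_ ws [ji wE]]]; apply: di; rewrite // ji wE.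
  - by move=> j /andP[_ /negbTE ji]; rewrite ffunE ji.
  - by move=> j /andP[_ /negbTE ji]; rewrite ffunE ji /g /dquad dot0p.
exists (- y) => z Dz.
apply: (@le_trans _ _ (phi z - phi z0)); last by rewrite gerBl phi0.
have [|t0 t00 Ht0] := @small_step R _
    [seq icd <- constraints | icd.2.2 < dotp icd.2.1 z0]
    (fun icd => (icd.2.2 - dotp icd.2.1 z0) / 2) (fun icd => - dotp icd.2.1 (z - z0)).
  move=> [i cd]; rewrite mem_filter => /andP[/= z0cd _]; left.
  by rewrite pmulr_llt0 // subr_lt0.
pose t := Num.min 1 t0.
have t_gt0 : 0 < t by rewrite lt_min ltr01.
have t1 : t <= 1 by rewrite ge_min lexx.
have tt0 : t <= t0 by rewrite ge_min lexx orbT.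
have t01 : 0 <= t <= 1 by rewrite ltW.
have [] := phi_convex _ _ _ t01 Dz D0.
have -> : t *: z + (1 - t) *: z0 = z0 + t *: (z - z0).
  by apply/rowP => j; rewrite !mxE; ring.
move=> Dt pt; have [i Pt] := domP _ Dt.
have Pi : P i z0.
  move=> cd cds; have [//|z0cd] := leP (dotp cd.1 z0) cd.2.
  have := Ht0 t t_gt0 tt0 (i, cd); rewrite mem_filter /= z0cd mem_constraints //.
  move=> /(_ isT); have := Pt _ cds; rewrite dotpDr dotpZr mulrN.
  by move=> /slack/[apply]; rewrite leNgt z0cd.
have acti : act i by apply/asboolP.
have := yg i (z - z0) acti _.
rewrite mulmxBl E0 subr0 => yz.
have {}yz : dotp (- y) (z *m E) <= g i (z - z0).
  apply: yz => cd cds z0cd; have := Pt _ cds.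
  by rewrite dotpDr dotpZr z0cd gerDl pmulr_rle0.
apply: le_trans yz _.
have Q0 := piece_psd _ _ _ Pi Pt; rewrite addrC addKr qformZ in Q0.
move: pt; rewrite (pieceP _ _ Pt).2 quad_line -/(g i _) -(pieceP _ _ Pi).2 => pt.
by rewrite -(ler_pM2l t_gt0); apply: slope pt.
Qed.

End PiecewiseQuadratic.

Section RealBounds.
Context {R : realType}.
Implicit Types (a b : \bar R).

Lemma lt_pinftyP a : (a < +oo)%E <-> exists r, (a <= r%:E)%E.
Proof.
split=> [|[r /le_lt_trans]]; last by apply; rewrite ltry.
by case: a => [r _||_] //; [exists r | exists 0; rewrite leNye].
Qed.

Lemma lee_realP a b : (forall r, (b <= r%:E)%E -> (a <= r%:E)%E) -> (a <= b)%E.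
Proof.
case: b => [b H|_|H]; [exact: H | exact: leey |].
case: a H => [a H|H|//]; last by have := H 0 (leNye _); rewrite leye_eq.
by have := H (a - 1) (leNye _); rewrite lee_fin lerDl oppr_ge0 ler10.
Qed.

Lemma dadde_leP a b c :
  ((a + b)%dE <= c%:E)%E <->
  exists r s, [/\ (a <= r%:E)%E, (b <= s%:E)%E & r + s <= c].
Proof.
split=> [|[r [s [ar bs rsc]]]]; last first.
  apply: (@le_trans _ _ (r + s)%:E); last by rewrite lee_fin.
  exact: (DualAddTheoryRealDomain.lee_dD ar bs).
case: a b => [a||] [b||] //=.
- by move=> abc; exists a, b; rewrite !lexx -lee_fin.
- by move=> _; exists a, (c - a); rewrite leNye lexx addrCA subrr addr0.
- by move=> _; exists (c - b), b; rewrite leNye lexx subrK.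
- by move=> _; exists c, 0; rewrite !leNye addr0.
Qed.

Lemma conjugate_leP p (h : 'rV[R]_p -> \bar R) v c :
  (conjugate h v <= c%:E)%E <->
  forall x r, (h x <= r%:E)%E -> dotp v x - r <= c.
Proof.
split=> [/ereal_supP H x r hr|H].
  rewrite -lee_fin; apply: le_trans (H ((dotp v x)%:E - h x)%E _); last by exists x.
  by rewrite EFinB leeB.
apply/ereal_supP => _ [x _ <-]; have := H x.
case: (h x) => [r||] Hr; last 1 first.
- have := Hr (dotp v x - c - 1) (leNye _).
  have -> : dotp v x - (dotp v x - c - 1) = c + 1 by ring.
  by rewrite gerDl ler10.
- by rewrite -EFinB lee_fin Hr.
- by rewrite /= leNye.
Qed.

Lemma subdiffP p (h : 'rV[R]_p -> \bar R) xb v :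
  subdiff h xb v <-> exists2 c, h xb = c%:E &
    forall x r, (h x <= r%:E)%E -> c + dotp v (x - xb) <= r.
Proof.
split=> [[/fineK hxb H]|[c hc H]].
  exists (fine (h xb)) => // x r hr; rewrite -lee_fin EFinD hxb.
  exact: le_trans (H x) hr.
split=> [|x]; first by rewrite hc.
rewrite hc -EFinD; apply: lee_realP => r /H.
by rewrite lee_fin.
Qed.

End RealBounds.

Lemma polyhedron_seq (R : realType) p (P : set 'rV[R]_p) : polyhedron P ->
  exists s : seq ('rV[R]_p * R), forall x, P x <->
    forall cd, cd \in s -> dotp cd.1 x <= cd.2.
Proof.
move=> [k [c [d ->]]]; exists [seq (c j, d j) | j <- enum 'I_k] => x.
split=> [H _ /mapP[j _ ->]|H j]; first exact: H.
by apply: (H (c j, d j)); apply/mapP; exists j; rewrite ?mem_enum.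
Qed.

Lemma multiplier_plq (R : realType) n m (f : 'rV[R]_(n + m) -> \bar R) v a :
  convex_fun f -> piecewise_linear_quadratic f ->
  (exists x r, (f (row_mx x 0) <= r%:E)%E) ->
  (forall x r, (f (row_mx x 0) <= r%:E)%E -> a + dotp v x <= r) ->
  exists y : 'rV[R]_m, forall x u r, (f (row_mx x u) <= r%:E)%E ->
    a + dotp v x + dotp y u <= r.
Proof.
move=> /convex_funP fc [I [P [A [q [u [polyP fP foo]]]]]] [x0 [r0 fx0]] f0.
have [s sP] := choice (fun i => polyhedron_seq _ _ _ (polyP i)).
pose vv : 'rV[R]_(n + m) := row_mx v 0.
pose E : 'M[R]_(n + m, m) := col_mx 0 1%:M.
have rowE (x : 'rV[R]_n) w : row_mx x w *m E = w.
  by rewrite mul_row_col mulmx0 mulmx1 add0r.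
pose D z := exists i, P i z.
pose phi z := fine (f z) - a - dotp vv z.
have fE z : D z -> f z = (phi z + a + dotp vv z)%:E.
  move=> [i Pz]; rewrite /phi (fP i) //=; congr (_%:E); ring.
have fD z r : (f z <= r%:E)%E -> D z.
  move=> fz; apply: contrapT => nD; move: fz; rewrite foo ?leye_eq // => -[i _ Pz].
  by apply: nD; exists i.
have vvE x w : dotp vv (row_mx x w) = dotp v x.
  by rewrite dotp_row_mx dot0p addr0.
have splitE (z : 'rV[R]_(n + m)) : z = row_mx (lsubmx z) (z *m E).
  by have := rowE (lsubmx z) (rsubmx z); rewrite hsubmxK => ->; rewrite hsubmxK.
have [x Dx||z z' t t01 Dz Dz'|||y Hy] := @plq_multiplier R (n + m) m D phi I s
  (fun i => 2^-1 *: (A i)^T) (fun i => q i - vv) (fun i => - u i - a) E.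
- by have [i Pi] := Dx; exists i; apply/sP.
- move=> i z /sP Pz; split; first by exists i.
  rewrite /phi (fP i) //= /quad /qform -scalemxAr dotpZr dotpBl; ring.
- have := fc _ _ _ _ _ t01 (eq_ind_r (fun w => w <= _)%E (lexx _) (fE z Dz))
    (eq_ind_r (fun w => w <= _)%E (lexx _) (fE z' Dz')).
  move=> ft; have Dt := fD _ _ ft; split=> //.
  by move: ft; rewrite fE // lee_fin dotpDr !dotpZr => ?; lra.
- exists (row_mx x0 0); last by rewrite rowE.
  exact: fD fx0.
- move=> z Dz zE; have := fE z Dz; rewrite (splitE z) zE vvE => fz.
  have := f0 (lsubmx z) (phi (row_mx (lsubmx z) 0) + a + dotp v (lsubmx z)).
  by rewrite fz lexx => /(_ isT) ?; lra.
exists y => x w r fx; have Dx := fD _ _ fx; have := Hy _ Dx; rewrite rowE.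
by move: fx; rewrite fE // lee_fin vvE => ? ?; lra.
Qed.

Lemma rint_extend (R : realType) p (A : set 'rV[R]_p) x0 z :
  rint A x0 -> A z -> exists2 t1, 0 < t1 &
    forall t, 0 < t -> t <= t1 -> A (x0 - t *: (z - x0)).
Proof.
move=> [Ax0 /nbhs_ballP[e /= e0 He]] Az.
pose d := 1 + \sum_j `|z 0 j - x0 0 j|.
have d0 : 0 < d by rewrite ltr_pwDl // sumr_ge0.
exists (e / d) => [|t t0]; first by rewrite divr_gt0.
rewrite ler_pdivlMr // => td; apply: He.
  split=> // i j; rewrite ord1 /ball /= !mxE opprB addrCA subrr addr0.
  rewrite normrM gtr0_norm //; apply: lt_le_trans td; rewrite ltr_pM2l //.
  rewrite /d (bigD1 j) //= addrCA ltr_pwDr //.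
  by rewrite ltr_pwDl // sumr_ge0.
move=> H [HA AH]; have -> : x0 - t *: (z - x0) = (1 - - t) *: x0 + (- t) *: z.
  by apply/rowP => j; rewrite !mxE; ring.
by apply: HA; apply: AH.
Qed.

Section CompositeDuality.
Context {R : realType} {n m : nat}.
Variables (f0 : 'rV[R]_n -> \bar R) (F : 'rV[R]_n -> option 'rV[R]_m)
          (g : 'rV[R]_m -> \bar R).
Implicit Types (x v : 'rV[R]_n) (u w y z : 'rV[R]_m) (r s t a c : R).

Lemma scalarize_leP y x c : (scalarize F y x <= c%:E)%E <->
  exists2 w, F x = Some w & dotp y w <= c.
Proof.
rewrite /scalarize; case: (F x) => [w|].
  by rewrite lee_fin; split=> [|[_ [<-]]//]; exists w.
by rewrite leye_eq; split=> // -[].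
Qed.

Lemma perturbation_leP x u c : (perturbation f0 F g (row_mx x u) <= c%:E)%E <->
  exists w r s, [/\ F x = Some w, (f0 x <= r%:E)%E, (g (w + u)%R <= s%:E)%E
    & r + s <= c].
Proof.
rewrite /perturbation row_mxKl row_mxKr; case: (F x) => [w|]; last first.
  by rewrite leye_eq; split=> // -[? [? [? []]]].
split=> [/dadde_leP[r [s [? ? ?]]]|[_ [r [s [[<-] ? ? ?]]]]].
  by exists w, r, s.
by apply/dadde_leP; exists r, s.
Qed.

Lemma compositeE x : composite f0 F g x = perturbation f0 F g (row_mx x 0).
Proof.
rewrite /composite /perturbation row_mxKl row_mxKr.
by case: (F x) => // w; rewrite addr0.
Qed.

Lemma composite_leP x c : (composite f0 F g x <= c%:E)%E <->
  exists w r s, [/\ F x = Some w, (f0 x <= r%:E)%E, (g w <= s%:E)%E & r + s <= c].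
Proof.
rewrite compositeE; split=> [/perturbation_leP|] [w [r [s]]].
  by rewrite addr0; exists w, r, s.
by move=> H; apply/perturbation_leP; exists w, r, s; rewrite addr0.
Qed.

Lemma sum_scalarize_leP y x c : (fun_dadde f0 (scalarize F y) x <= c%:E)%E <->
  exists w r, [/\ F x = Some w, (f0 x <= r%:E)%E & r + dotp y w <= c].
Proof.
split=> [/dadde_leP[r [s [? /scalarize_leP[w Fx ys] rs]]]|[w [r [Fx fr rc]]]].
  by exists w, r; split=> //; apply: le_trans rs; rewrite lerD2l.
apply/dadde_leP; exists r, (dotp y w); split=> //.
by apply/scalarize_leP; exists w.
Qed.

Lemma perturbation_domainP u : perturbation_domain f0 F g u <->
  exists x r, (perturbation f0 F g (row_mx x u) <= r%:E)%E.
Proof.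
split=> [[z /lt_pinftyP[s gs] [w [x [/lt_pinftyP[r fr] _] Fx] <-]]|].
  exists x, (r + s); apply/perturbation_leP; exists w, r, s.
  by rewrite addrC subrK.
move=> [x [c /perturbation_leP[w [r [s [Fx fr gs _]]]]]].
exists (w + u); first by apply/lt_pinftyP; exists s.
exists w; last by rewrite addrC addKr.
exists x => //; split; first by apply/lt_pinftyP; exists r.
by rewrite /vdom /= Fx.
Qed.

Lemma convex_composite : convex_fun (perturbation f0 F g) ->
  convex_fun (composite f0 F g).
Proof.
move=> /convex_funP fc; apply/convex_funP => x y r s t t01.
rewrite !compositeE => fx fy; have := fc _ _ _ _ _ t01 fx fy.
by rewrite !scale_row_mx add_row_mx !scaler0 addr0.
Qed.

Lemma conjugate_composite_le v :
  (conjugate (composite f0 F g) v <= rho f0 F g v)%E.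
Proof.
apply/ereal_infP => _ [y _ <-]; apply: lee_realP => c.
move=> /dadde_leP[c1 [c2 [/conjugate_leP H1 /conjugate_leP H2 cc]]].
apply/conjugate_leP => x t /composite_leP[w [r [s [Fx fr gs rs]]]].
have := H2 _ _ gs; have := H1 x (r + dotp y w) _.
have -> : (fun_dadde f0 (scalarize F y) x <= (r + dotp y w)%:E)%E.
  by apply/sum_scalarize_leP; exists w, r.
by move=> /(_ isT) ? ?; lra.
Qed.

Lemma rho_le_rho_tilde v : (rho f0 F g v <= rho_tilde f0 F g v)%E.
Proof.
apply/ereal_infP => _ [y _ [v' _ <-]]; apply: lee_realP => c.
move=> /dadde_leP[c12 [c3 [/dadde_leP[c1 [c2 [/conjugate_leP H1 /conjugate_leP H2]]]]]].
move=> cc12 H3 cc; apply: ge_ereal_inf; eexists; first by exists y.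
apply/dadde_leP; exists c12, c3; split=> //; apply/conjugate_leP => x t.
move=> /sum_scalarize_leP[w [r [Fx fr rt]]].
have := H1 _ _ fr; have := H2 x (dotp y w) _.
have -> : (scalarize F y x <= (dotp y w)%:E)%E by apply/scalarize_leP; exists w.
by move=> /(_ isT); rewrite dotpBl => ? ?; lra.
Qed.

Lemma subdiff_composite_sub xb w : F xb = Some w ->
  \bigcup_(yb in subdiff g w) subdiff (fun_dadde f0 (scalarize F yb)) xb
    `<=` subdiff (composite f0 F g) xb.
Proof.
move=> Fxb v [y /subdiffP[s0 gw Hg] /subdiffP[c hc Hf]].
have [r0 f0xb cE] : exists2 r, f0 xb = r%:E & c = r + dotp y w.
  move: hc; rewrite /fun_dadde /scalarize Fxb; case: (f0 xb) => //= r [<-].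
  by exists r.
apply/subdiffP; exists (r0 + s0) => [|x t].
  by rewrite /composite Fxb f0xb gw.
move=> /composite_leP[w' [r [s [Fx fr gs rs]]]].
have := Hg _ _ gs; have := Hf x (r + dotp y w') _.
have -> : (fun_dadde f0 (scalarize F y) x <= (r + dotp y w')%:E)%E.
  by apply/sum_scalarize_leP; exists w', r.
by move=> /(_ isT); rewrite cE (dotpBr y) => ? ?; lra.
Qed.

Lemma mink_add_subdiff_sub xb w : F xb = Some w ->
  mink_add (subdiff f0 xb)
      (\bigcup_(yb in subdiff g w) subdiff (scalarize F yb) xb)
    `<=` \bigcup_(yb in subdiff g w) subdiff (fun_dadde f0 (scalarize F yb)) xb.
Proof.
move=> Fxb _ [v1 /subdiffP[r0 fr0 H1] [v2 [y yg /subdiffP[c hc H2]] <-]].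
exists y => //; apply/subdiffP; exists (r0 + c).
  by rewrite /fun_dadde fr0 hc.
move=> x t /sum_scalarize_leP[w' [r [Fx fr rt]]].
have := H1 _ _ fr; have := H2 x (dotp y w') _.
have -> : (scalarize F y x <= (dotp y w')%:E)%E by apply/scalarize_leP; exists w'.
by move=> /(_ isT); rewrite dotpDl => ? ?; lra.
Qed.

(* y is a Lagrange multiplier certifying the lower bound a of the tilted
   perturbation f(x, u) - <v, x> at u = 0. *)
Definition multiplier a v y := forall x u r,
  (perturbation f0 F g (row_mx x u) <= r%:E)%E -> a + dotp v x + dotp y u <= r.

Lemma multiplierP a v y x w z r s : multiplier a v y -> F x = Some w ->
  (f0 x <= r%:E)%E -> (g z <= s%:E)%E -> a + dotp v x + dotp y (z - w) <= r + s.
Proof.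
move=> My Fx fr gs; apply: My; apply/perturbation_leP; exists w, r, s.
by rewrite addrC subrK.
Qed.

Lemma multiplier_conjugate a v y :
  (exists x w r, F x = Some w /\ (f0 x <= r%:E)%E) ->
  (exists z s, (g z <= s%:E)%E) -> multiplier a v y ->
  ((conjugate (fun_dadde f0 (scalarize F y)) v + conjugate g y)%dE <= (- a)%:E)%E.
Proof.
move=> [x0 [w0 [r0 [Fx0 fr0]]]] [z0 [s0 gs0]] My.
have [c2 c2E] : exists c2, conjugate g y = c2%:E.
  have : (conjugate g y <= (r0 - a - dotp v x0 + dotp y w0)%:E)%E.
    apply/conjugate_leP => z s gs.
    by have := multiplierP _ _ _ _ _ _ _ _ My Fx0 fr0 gs; rewrite dotpBr => ?; lra.
  have : conjugate g y <> -oo%E.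
    move=> gN; have : (conjugate g y <= (dotp y z0 - s0 - 1)%:E)%E.
      by rewrite gN leNye.
    by move=> /conjugate_leP/(_ _ _ gs0); rewrite lerDl oppr_ge0 ler10.
  by case: (conjugate g y) => [c2 _ _||//]; [exists c2 | rewrite leye_eq].
apply/dadde_leP; exists (- a - c2), c2; split; rewrite ?c2E ?subrK //.
apply/conjugate_leP => x t /sum_scalarize_leP[w [r [Fx fr rt]]].
suff : c2 <= r - a - dotp v x + dotp y w by move=> ?; lra.
rewrite -lee_fin -c2E; apply/conjugate_leP => z s gs.
by have := multiplierP _ _ _ _ _ _ _ _ My Fx fr gs; rewrite dotpBr => ?; lra.
Qed.

Lemma multiplier_subdiff v y xb w r0 s0 : F xb = Some w ->
  f0 xb = r0%:E -> g w = s0%:E -> multiplier (r0 + s0 - dotp v xb) v y ->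
  subdiff g w y /\ subdiff (fun_dadde f0 (scalarize F y)) xb v.
Proof.
move=> Fxb fr0 gs0 My; split; apply/subdiffP.
  exists s0 => // z s gs; have fr : (f0 xb <= r0%:E)%E by rewrite fr0.
  by have := multiplierP _ _ _ _ _ _ _ _ My Fxb fr gs => ?; lra.
exists (r0 + dotp y w); first by rewrite /fun_dadde /scalarize Fxb fr0.
move=> x t /sum_scalarize_leP[w' [r [Fx fr rt]]].
have gs : (g w <= s0%:E)%E by rewrite gs0.
have := multiplierP _ _ _ _ _ _ _ _ My Fx fr gs.
by rewrite !dotpBr => ?; lra.
Qed.

Lemma exists_multiplier a v : convex_fun (perturbation f0 F g) ->
  (forall x r, (composite f0 F g x <= r%:E)%E -> a + dotp v x <= r) ->
  let U := perturbation_domain f0 F g in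
  rint U 0 \/ (U 0 /\ piecewise_linear_quadratic (perturbation f0 F g)) ->
  exists y, multiplier a v y.
Proof.
move=> fc H /= [U0|[U0 plq]].
  apply: multiplier_rint => // [x r|x u r fx]; first by rewrite -compositeE; apply: H.
  have Uu : perturbation_domain f0 F g u by apply/perturbation_domainP; exists x, r.
  have [t t0 Ht] := rint_extend _ _ _ _ _ U0 Uu; exists t => //.
  have /perturbation_domainP := Ht t t0 (lexx _).
  by rewrite subr0 sub0r scaleNr.
apply: multiplier_plq => //; first exact/perturbation_domainP.
by move=> x r; rewrite -compositeE; apply: H.
Qed.

Hypothesis g_proper : proper_fun g.

Lemma convex_scalarize y : convex_fun (perturbation_g F g) ->
  edom (conjugate g) y -> convex_fun (scalarize F y).
Proof.
move=> /convex_funP hc /lt_pinftyP[c0 yc0]; apply/convex_funP => x1 x2 r1 r2 t t01.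
move=> /scalarize_leP[w1 F1 yw1] /scalarize_leP[w2 F2 yw2].
pose wt := t *: w1 + (1 - t) *: w2.
have hx x w z : F x = Some w -> perturbation_g F g (row_mx x (z - w)) = g z.
  by move=> Fx; rewrite /perturbation_g row_mxKl row_mxKr Fx addrC subrK.
have Ht z s : (g z <= s%:E)%E -> exists2 w, F (t *: x1 + (1 - t) *: x2) = Some w &
    (g (w + (z - wt))%R <= s%:E)%E.
  move=> gs; have g1 := gs; have g2 := gs.
  rewrite -(hx _ _ z F1) in g1; rewrite -(hx _ _ z F2) in g2.
  have := hc _ _ _ _ _ t01 g1 g2; rewrite !scale_row_mx add_row_mx.
  have -> : t *: (z - w1) + (1 - t) *: (z - w2) = z - wt.
    by apply/rowP => j; rewrite !mxE; ring.
  have -> : t * s + (1 - t) * s = s by ring.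
  rewrite /perturbation_g row_mxKl row_mxKr; case: (F _) => [w|].
    by exists w.
  by rewrite leye_eq.
have [[z0 gz0] gN] := g_proper.
have [s0 gs0] : exists s, (g z0 <= s%:E)%E.
  by apply/lt_pinftyP; rewrite lt_neqAle leey andbT; apply/eqP.
have [w Fw _] := Ht _ _ gs0.
have [c cE] : exists c, conjugate g y = c%:E.
  case: (conjugate g y) yc0 (conjugate_leP _ g y (dotp y z0 - s0 - 1)) => [c _ _||].
  - by exists c.
  - by rewrite leye_eq.
  - move=> _ [/(_ (leNye _))/(_ _ _ gs0)].
    by rewrite lerDl oppr_ge0 ler10.
apply/scalarize_leP; exists w => //.
apply/ler_addgt0Pr => e e0.
have [z [s [gs ze]]] : exists z s, (g z <= s%:E)%E /\ c - e < dotp y z - s.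
  apply: contrapT => nH; have : (conjugate g y <= (c - e)%:E)%E.
    apply/conjugate_leP => z s gs; rewrite leNgt; apply/negP => ze.
    by apply: nH; exists z, s.
  by rewrite cE lee_fin lerDl oppr_ge0 leNgt e0.
have [w' Fw' gw'] := Ht _ _ gs.
have ww' : w' = w by move: Fw'; rewrite Fw => -[].
have : (conjugate g y <= c%:E)%E by rewrite cE.
move=> /conjugate_leP/(_ _ _ gw'); rewrite ww' !dotpDr dotpNr /wt dotpDr !dotpZr.
have /andP[t0 t1] := t01.
have := ler_wpM2l t0 yw1; have t1' : 0 <= 1 - t by rewrite subr_ge0.
by have := ler_wpM2l t1' yw2 => ? ? ?; lra.
Qed.

End CompositeDuality.

(* For F = Some the perturbation domain is dom k - dom f0, and the hypothesis on
   the relative interiors gives the symmetry required by multiplier_rint. *)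
Lemma exists_sum_multiplier (R : realType) n (f0 k : 'rV[R]_n -> \bar R) a v :
  convex_fun f0 -> convex_fun k ->
  rint (edom f0) `&` rint (edom k) !=set0 ->
  (forall x r, (fun_dadde f0 k x <= r%:E)%E -> a + dotp v x <= r) ->
  exists y, multiplier f0 Some k a v y.
Proof.
move=> /convex_funP f0c /convex_funP kc [x0 [rf rk]] H.
apply: multiplier_rint => [|x r|x u r].
- apply/convex_funP => z1 z2 c1 c2 t /[dup] t01 /andP[t0 t1].
  rewrite -(hsubmxK z1) -(hsubmxK z2) => /perturbation_leP[_ [r1 [s1 [[<-] f1 k1 rs1]]]].
  move=> /perturbation_leP[_ [r2 [s2 [[<-] f2 k2 rs2]]]].
  rewrite !scale_row_mx add_row_mx; apply/perturbation_leP.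
  exists (t *: lsubmx z1 + (1 - t) *: lsubmx z2), (t * r1 + (1 - t) * r2).
  exists (t * s1 + (1 - t) * s2); split=> //; first exact: f0c.
    have := kc _ _ _ _ _ t01 k1 k2; congr (k _ <= _)%E.
    by apply/rowP => j; rewrite !mxE; ring.
  have t1' : 0 <= 1 - t by rewrite subr_ge0.
  by have := ler_wpM2l t0 rs1; have := ler_wpM2l t1' rs2 => ? ?; lra.
- by rewrite -compositeE; apply: H.
- move=> /perturbation_leP[_ [r1 [s1 [[<-] f1 k1 _]]]].
  have f1' : edom f0 x by apply/lt_pinftyP; exists r1.
  have k1' : edom k (x + u) by apply/lt_pinftyP; exists s1.
  have [ta ta0 Ha] := rint_extend _ _ _ _ _ rf f1'.
  have [tb tb0 Hb] := rint_extend _ _ _ _ _ rk k1'.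
  have t0 : 0 < Num.min ta tb by rewrite lt_min ta0.
  exists (Num.min ta tb) => //.
  have /lt_pinftyP[r2 f2] := Ha _ t0 ltac:(by rewrite ge_min lexx).
  have /lt_pinftyP[s2 k2] := Hb _ t0 ltac:(by rewrite ge_min lexx orbT).
  exists (x0 - Num.min ta tb *: (x - x0)), (r2 + s2).
  apply/perturbation_leP; exists (x0 - Num.min ta tb *: (x - x0)), r2, s2.
  split=> //; move: k2; congr (k _ <= _)%E.
  by apply/rowP => j; rewrite !mxE; ring.
Qed.

Theorem proposition3p1 (R : realType) (n m : nat)
    (f0 : 'rV[R]_n -> \bar R) (F : 'rV[R]_n -> option 'rV[R]_m)
    (g : 'rV[R]_m -> \bar R) (f h : 'rV[R]_(n + m) -> \bar R)
    (U : set 'rV[R]_m)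
    (f_def : f = perturbation f0 F g)
    (h_def : h = perturbation_g F g)
    (U_def : U = perturbation_domain f0 F g)
    (f0_Gamma : Gamma f0)
    (f_Gamma : Gamma f)
    (h_Gamma : Gamma h)
    (h_closed_u : forall x : 'rV[R]_n,
        closed_fun (fun u : 'rV[R]_m => h (row_mx x u))) :
  [/\ convex_fun (composite f0 F g),
      forall yb, edom (conjugate g) yb ->
        Gamma (fun_dadde f0 (scalarize F yb)) /\ Gamma (scalarize F yb),
      forall vb,
        (conjugate (composite f0 F g) vb <= rho f0 F g vb)%E /\
        (rho f0 F g vb <= rho_tilde f0 F g vb)%E,
      forall xb w, edom (composite f0 F g) xb -> F xb = Some w ->
        (\bigcup_(yb in subdiff g w) subdiff (fun_dadde f0 (scalarize F yb)) xb
           `<=` subdiff (composite f0 F g) xb) /\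
        (mink_add (subdiff f0 xb)
              (\bigcup_(yb in subdiff g w) subdiff (scalarize F yb) xb)
           `<=` \bigcup_(yb in subdiff g w)
                  subdiff (fun_dadde f0 (scalarize F yb)) xb)
    & Gamma0 f ->
      rint (edom f0) `&` rint (vdom F) !=set0 ->
      rint U 0 \/ (U 0 /\ piecewise_linear_quadratic f) ->
      (forall vb,
         conjugate (composite f0 F g) vb = rho f0 F g vb /\
         rho f0 F g vb = rho_tilde f0 F g vb) /\
      (forall xb w, edom (composite f0 F g) xb -> F xb = Some w ->
         subdiff (composite f0 F g) xb =
           \bigcup_(yb in subdiff g w) subdiff (fun_dadde f0 (scalarize F yb)) xb /\
         \bigcup_(yb in subdiff g w) subdiff (fun_dadde f0 (scalarize F yb)) xb =
           mink_add (subdiff f0 xb)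
                (\bigcup_(yb in subdiff g w) subdiff (scalarize F yb) xb))].

Proof.
subst f h U; have [f0P f0c] := f0_Gamma; have [fP fc] := f_Gamma.
have [hP hc] := h_Gamma.
have [x1 [w1 F1]] : exists x w, F x = Some w.
  have [[z]] := hP; rewrite /perturbation_g.
  by case E : (F (lsubmx z)) => [w|//]; exists (lsubmx z), w.
have hE z : perturbation_g F g (row_mx x1 (z - w1)) = g z.
  by rewrite /perturbation_g row_mxKl row_mxKr F1 addrC subrK.
have finiteP p (k : 'rV[R]_p -> \bar R) z : k z <> +oo%E -> exists r, (k z <= r%:E)%E.
  by move=> kz; apply/lt_pinftyP; rewrite lt_neqAle leey andbT; apply/eqP.
have [gP [z1 [s1 gs1]]] : proper_fun g /\ exists z s, (g z <= s%:E)%E.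
  have [[z]] := hP; rewrite /perturbation_g.
  case E : (F (lsubmx z)) => [w|//] gw; split; last first.
    by exists (w + rsubmx z); apply: finiteP.
  by split=> [|u]; [exists (w + rsubmx z) | rewrite -hE; apply: hP.2].
have [x0 [w0 [r0 [Fx0 fr0]]]] : exists x w r, F x = Some w /\ (f0 x <= r%:E)%E.
  have [[z /finiteP[c]]] := fP; rewrite -(hsubmxK z).
  by move=> /perturbation_leP[w [r [s [? ? _ _]]]]; exists (lsubmx z), w, r.
have dom0 : exists x w r, F x = Some w /\ (f0 x <= r%:E)%E by exists x0, w0, r0.
have yGamma y : edom (conjugate g) y ->
    Gamma (fun_dadde f0 (scalarize F y)) /\ Gamma (scalarize F y).
  move=> /(convex_scalarize _ _ gP _ hc) yc.
  have yN x : (-oo < scalarize F y x)%E.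
    by rewrite /scalarize; case: (F x) => // w; rewrite ltNyr.
  split; split=> //.
  - split=> [|x]; last first.
      rewrite /fun_dadde; move: (f0P.2 x) (yN x).
      by case: (f0 x) => [a||] //; case: (scalarize F y x) => [b||] //= _ _; rewrite ltNyr.
    exists x0 => fy; have : (fun_dadde f0 (scalarize F y) x0 <= (r0 + dotp y w0)%:E)%E.
      by apply/sum_scalarize_leP; exists w0, r0.
    by rewrite fy leye_eq.
  - move: f0c yc => /convex_funP f0c /convex_funP yc; apply/convex_funP.
    move=> z z' c c' t /[dup] t01 /andP[t0 t1].
    move=> /dadde_leP[r [s [fr ys rs]]] /dadde_leP[r' [s' [fr' ys' rs']]].
    apply/dadde_leP; exists (t * r + (1 - t) * r'), (t * s + (1 - t) * s').
    split; [exact: f0c | exact: yc |].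
    have t1' : 0 <= 1 - t by rewrite subr_ge0.
    by have := ler_wpM2l t0 rs; have := ler_wpM2l t1' rs' => ? ?; lra.
  - by split=> //; exists x1; rewrite /scalarize F1.
split=> //.
- exact: convex_composite.
- by move=> v; split; [exact: conjugate_composite_le | exact: rho_le_rho_tilde].
- move=> xb w _ Fxb; split; first exact: subdiff_composite_sub.
  exact: mink_add_subdiff_sub.
move=> _ rintFf qual.
have sum_mult y v a : edom (conjugate g) y ->
    (forall x r, (fun_dadde f0 (scalarize F y) x <= r%:E)%E -> a + dotp v x <= r) ->
    exists v', multiplier f0 Some (scalarize F y) a v v'.
  move=> /yGamma[_ [_ yc]]; apply: exists_sum_multiplier => //.
  suff -> : edom (scalarize F y) = vdom F by [].
  apply/seteqP; split=> x; rewrite /edom /vdom /scalarize /=; case: (F x) => //.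
  by move=> w _; rewrite ltry.
have idE v' v : conjugate (fun_dadde f0 (scalarize Some v')) v = conjugate f0 (v - v').
  apply/eqP; rewrite eq_le; apply/andP; split; apply: lee_realP => c.
    move=> /conjugate_leP H; apply/conjugate_leP => x t.
    move=> /sum_scalarize_leP[_ [r [[<-] fr rt]]].
    by have := H _ _ fr; rewrite dotpBl => ?; lra.
  move=> /conjugate_leP H; apply/conjugate_leP => x r fr.
  rewrite dotpBl -addrA -opprD (addrC (dotp v' x)); apply: H.
  by apply/sum_scalarize_leP; exists x, r.
split=> [v|xb w]; last first.
  move=> /lt_pinftyP[c0 comp0] Fxb.
  have [r1 [r2 [fr1 gr2]]] : exists r s, f0 xb = r%:E /\ g w = s%:E.
    move: comp0 => /composite_leP[w' [r [s [Fw' fr gs _]]]].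
    move: Fw'; rewrite Fxb => -[ww']; rewrite -ww' in gs.
    move: (f0P.2 xb) (gP.2 w) fr gs.
    case: (f0 xb) => [a||] //; case: (g w) => [b||] //=; rewrite ?leye_eq //.
    by exists a, b.
  split; apply/seteqP; split.
  - move=> v /subdiffP[c cE Hv].
    have [|y My] := exists_multiplier f0 F g (r1 + r2 - dotp v xb) v fc _ qual.
      move=> x r /Hv; move: cE; rewrite /composite Fxb fr1 gr2 dotpBr => -[<-].
      by move=> ?; lra.
    have [yg yv] := multiplier_subdiff _ _ _ _ _ _ _ _ _ Fxb fr1 gr2 My.
    by exists y.
  - exact: subdiff_composite_sub.
  - move=> v [y yg /subdiffP[c cE Hv]].
    have yd : edom (conjugate g) y.
      have /subdiffP[s sE Hg] := yg; apply/lt_pinftyP; exists (dotp y w - s).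
      apply/conjugate_leP => z t gz; have := Hg _ _ gz; rewrite dotpBr => ?; lra.
    have yxb : scalarize F y xb = (dotp y w)%:E by rewrite /scalarize Fxb.
    have [|v' Mv] := sum_mult y v (r1 + dotp y w - dotp v xb) yd.
      move=> x r /Hv; move: cE; rewrite /fun_dadde fr1 yxb dotpBr => -[<-].
      by move=> ?; lra.
    have [yv' /subdiffP[c' c'E Hv']] :=
      multiplier_subdiff _ _ _ _ _ _ _ _ _ (erefl (Some xb)) fr1 yxb Mv.
    exists (v - v'); last by exists v'; [exists y | rewrite subrK].
    apply/subdiffP; exists r1 => // x r fr.
    have := Hv' x (r + dotp v' x) _; move: c'E.
    rewrite /fun_dadde /scalarize fr1 => -[<-].
    rewrite dotpBl (dotpBr v') => H; suff : r1 + dotp v' xb + dotp v (x - xb) <= r + dotp v' x.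
      by move=> ?; lra.
    by apply: H; apply/dadde_leP; exists r, (dotp v' x).
  - exact: mink_add_subdiff_sub.
have [x2 [c2 fx2]] : exists x r, (composite f0 F g x <= r%:E)%E.
  have U0 : perturbation_domain f0 F g 0 by case: qual => [[]|[]].
  by have /perturbation_domainP[x [r]] := U0; rewrite -compositeE; exists x, r.
have rho_comp : rho f0 F g v = conjugate (composite f0 F g) v.
  apply/eqP; rewrite eq_le conjugate_composite_le andbT; apply: lee_realP => c.
  move=> /conjugate_leP Hc.
  have [|y My] := exists_multiplier f0 F g (- c) v fc _ qual.
    by move=> x r /Hc => ?; lra.
  apply: ge_ereal_inf; eexists; first by exists y.
  rewrite -[c]opprK; apply: multiplier_conjugate My => //.
  by exists z1, s1.
split; first by rewrite rho_comp.
apply/eqP; rewrite eq_le rho_le_rho_tilde /=; apply/ereal_infP => _ [y _ <-].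
apply: lee_realP => c /dadde_leP[a1 [a2 [/conjugate_leP H1 H2 a12]]].
have yd : edom (conjugate g) y by apply/lt_pinftyP; exists a2.
have [|v' Mv] := sum_mult y v (- a1) yd.
  by move=> x r /H1 => ?; lra.
apply: ge_ereal_inf; eexists.
  by exists y => //; exists (v - v').
apply/dadde_leP; exists a1, a2; split=> //.
have -> : v - (v - v') = v' by rewrite opprB addrC subrK.
rewrite -idE -[a1]opprK; apply: multiplier_conjugate Mv; first by exists x0, x0, r0.
by exists x0, (dotp y w0); apply/scalarize_leP; exists w0.
Qed.
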